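(* $(\mathrm{Mod}(T_2),\cong)$ is Borel reducible to $(\mathrm{Mod}(\mathrm{REF(bin)}),\cong)$.
   Context: For a first-order theory or $L_{\omega_1,\omega}$-sentence $\Phi$ in a countable language, $\mathrm{Mod}(\Phi)$ is the set of models of $\Phi$ with universe $\omega$, a standard Borel space with the usual logic topology. A Borel reduction from $(\mathrm{Mod}(\Phi),\cong)$ to $(\mathrm{Mod}(\Psi),\cong)$ is a Borel map $f$ with $M\cong N\iff f(M)\cong f(N)$. $\mathrm{REF(bin)}$ is the first-order theory in the language $\{E_n:n\in\omega\}$ asserting: each $E_n$ is an equivalence relation, $E_0$ has a single class, each $E_{n+1}$ refines $E_n$, and each $E_n$-class is partitioned into exactly two $E_{n+1}$-classes. Jump: for a theory $\Phi$ in a countable relational language $L$, $J(\Phi)$ is the theory in $L\cup\{E\}$ ($E$ a new binary symbol) saying that $E$ is an equivalence relation with infinitely many classes, each class is (as an $L$-structure) a model of $\Phi$, and $R(\bar x)$ is false for $R\in L$ whenever $\bar x$ is not contained in a single $E$-class. $T_0$ is the complete theory of $(\mathbb Z,S)$ with $S$ the graph of the successor function, $T_1=J(T_0)$, $T_2=J(T_1)$. ($T_2$ is Borel bireducible with the relation $F_2$ on $(2^\omega)^\omega$ of enumerating the same countable set of reals.) *)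

(* Defs.v *)
From HB Require Import structures.
From mathcomp Require Import all_boot all_order all_algebra.
From mathcomp Require Import all_classical.
From mathcomp Require Import measurable_structure topology.

Set Implicit Arguments.
Unset Strict Implicit.
Unset Printing Implicit Defensive.

Import GRing.Theory.

Local Open Scope classical_set_scope.

Record language := Language { symbol :> countType; arity : symbol -> nat }.

(* A structure is its atomic diagram.  With the product topology of discrete
   two-point spaces, [structure L nat] is the space of L-structures with
   universe omega with the logic topology. *)
Definition structure (L : language) (U : Type) : Type :=
  prod_topology (fun _ : {R : L & (arity R).-tuple U} => bool).

HB.instance Definition _ (L : language) (U : Type) :=
  Topological.copy (structure L U)
    (prod_topology (fun _ : {R : L & (arity R).-tuple U} => bool)).

Definition holds (L : language) (U : Type) (M : structure L U) (R : L)
    (a : (arity R).-tuple U) : bool := M (existT _ R a).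
Arguments holds {L U} M R a.

(* Well-scoped de Bruijn syntax: [formula L n] has its free variables among
   0, ..., n.-1, and a quantifier binds variable 0 of its body. *)
Inductive formula (L : language) : nat -> Type :=
| Bot n : formula L n
| Equal n (i j : 'I_n) : formula L n
| Atom n (R : L) (a : (arity R).-tuple 'I_n) : formula L n
| Imp n (p q : formula L n) : formula L n
| And n (p q : formula L n) : formula L n
| Or n (p q : formula L n) : formula L n
| All n (p : formula L n.+1) : formula L n
| Ex n (p : formula L n.+1) : formula L n.
Arguments Bot {L n}.
Arguments Equal {L n} i j.
Arguments Atom {L n} R a.
Arguments Imp {L n} p q.
Arguments And {L n} p q.
Arguments Or {L n} p q.
Arguments All {L n} p.
Arguments Ex {L n} p.

Notation Not p := (Imp p Bot).
Notation Top := (Imp Bot Bot).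

Definition v0 n : 'I_n.+1 := ord0.
Definition v1 n : 'I_n.+2 := lift ord0 (v0 n).
Definition v2 n : 'I_n.+3 := lift ord0 (v1 n).
Arguments v0 {n}.
Arguments v1 {n}.
Arguments v2 {n}.

Section Satisfaction.
Variables (L : language) (U : Type) (M : structure L U).

Fixpoint sat (n : nat) (p : formula L n) : n.-tuple U -> Prop :=
  match p in formula _ n return n.-tuple U -> Prop with
  | Bot _ => fun _ => False
  | Equal _ i j => fun v => tnth v i = tnth v j
  | Atom _ R a => fun v => holds M R (map_tuple (tnth v) a)
  | Imp _ p q => fun v => sat p v -> sat q v
  | And _ p q => fun v => sat p v /\ sat q v
  | Or _ p q => fun v => sat p v \/ sat q v
  | All _ p => fun v => forall x : U, sat p (cons_tuple x v)
  | Ex _ p => fun v => exists x : U, sat p (cons_tuple x v)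
  end.

End Satisfaction.

Fixpoint universal_closure (L : language) (n : nat) : formula L n -> formula L 0 :=
  match n with
  | 0 => fun p => p
  | n'.+1 => fun p => universal_closure (All p)
  end.

Definition theory (L : language) := set (formula L 0).

Definition models (L : language) (U : Type) (M : structure L U)
  (T : theory L) : Prop := forall p, T p -> sat M p [tuple].

Definition complete_theory (L : language) (U : Type) (M : structure L U) :
  theory L := [set p | sat M p [tuple]].

Definition isomorphic (L : language) (U V : Type) (M : structure L U)
    (N : structure L V) : Prop :=
  exists2 g : U -> V, bijective g &
    forall (R : L) (a : (arity R).-tuple U),
      holds M R a = holds N R (map_tuple g a).

(* Coerced to a type, [Mod T] carries the topology induced by
   [structure L nat]. *)
Definition Mod (L : language) (T : theory L) : set (structure L nat) :=
  [set M | models M T].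

Definition Mod_iso (L : language) (T : theory L) (M N : Mod T) : Prop :=
  isomorphic (set_val M) (set_val N).
Arguments Mod_iso {L} T M N.

Definition borel (X : topologicalType) : set (set X) := <<s @open X >>.
Arguments borel {X}.

Definition borel_map (X Y : topologicalType) (f : X -> Y) : Prop :=
  forall B : set Y, borel B -> borel (f @^-1` B).

Definition borel_reducible (X Y : topologicalType)
    (E : X -> X -> Prop) (F : Y -> Y -> Prop) : Prop :=
  exists2 f : X -> Y, borel_map f & forall x y, E x y <-> F (f x) (f y).

Definition equivalence_axioms (L : language)
    (E : forall n, 'I_n -> 'I_n -> formula L n) : theory L :=
  [set All (E 1 v0 v0);
       All (All (Imp (E 2 v0 v1) (E 2 v1 v0)));
       All (All (All (Imp (And (E 3 v0 v1) (E 3 v1 v2))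
                          (E 3 v0 v2))))].

(* [None] is the new binary symbol. *)
Definition jump_language (L : language) : language :=
  @Language (option L) (fun R => if R is Some R' then arity R' else 2).

Definition class_atom (L : language) (n : nat) (i j : 'I_n) :
  formula (jump_language L) n := @Atom (jump_language L) n None [tuple i; j].
Arguments class_atom {L} n i j.

(* Restricts the quantifiers of [p] to the class of a fresh free variable,
   which is the last one, [ord_max]. *)
Fixpoint relativize (L : language) (n : nat) (p : formula L n) :
    formula (jump_language L) n.+1 :=
  match p in formula _ n return formula (jump_language L) n.+1 with
  | Bot _ => Bot
  | Equal n i j => Equal (widen_ord (leqnSn n) i) (widen_ord (leqnSn n) j)
  | Atom n R a =>
      @Atom (jump_language L) n.+1 (Some R)
        (map_tuple (widen_ord (leqnSn n)) a)
  | Imp _ p q => Imp (relativize p) (relativize q)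
  | And _ p q => And (relativize p) (relativize q)
  | Or _ p q => Or (relativize p) (relativize q)
  | All _ p => All (Imp (class_atom _ ord_max ord0) (relativize p))
  | Ex _ p => Ex (And (class_atom _ ord_max ord0) (relativize p))
  end.

(* For any n elements some element is in none of their classes. *)
Definition more_classes (L : language) (n : nat) :
    formula (jump_language L) 0 :=
  universal_closure
    (Ex (\big[And/Top]_(i < n) Not (class_atom n.+1 (lift ord0 i) ord0))).

Definition local_atom (L : language) (R : L) (i j : 'I_(arity R)) :
    formula (jump_language L) 0 :=
  universal_closure
    (Imp (@Atom (jump_language L) (arity R) (Some R) (ord_tuple (arity R)))
         (class_atom (arity R) i j)).

Definition jump (L : language) (T : theory L) : theory (jump_language L) :=
  equivalence_axioms (@class_atom L)
  `|` range (@more_classes L)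
  `|` [set All (relativize p) | p in T]
  `|` [set p | exists (R : L) (i j : 'I_(arity R)), p = local_atom i j].

Definition succ_language : language := @Language unit (fun _ => 2).

Definition int_succ : structure succ_language int :=
  fun Ra => let a : 2.-tuple int := projT2 Ra in
    (tnth a v1 == tnth a v0 + 1)%R.

Definition T0 : theory succ_language := complete_theory int_succ.
Definition T1 : theory (jump_language succ_language) := jump T0.
Definition T2 : theory (jump_language (jump_language succ_language)) := jump T1.

Definition REF_language : language := @Language nat (fun _ => 2).

Definition REF_atom (k n : nat) (i j : 'I_n) : formula REF_language n :=
  @Atom REF_language n k [tuple i; j].
Arguments REF_atom k {n} i j.

Definition REF_refines (k : nat) : formula REF_language 0 :=
  All (All (Imp (REF_atom k.+1 v0 v1) (REF_atom k v0 v1))).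

(* For every x there is y in the E_k-class of x, but not in its
   E_(k+1)-class, such that these two E_(k+1)-classes cover the E_k-class.
   In the body x, y, z are the variables 2, 1, 0. *)
Definition REF_splits (k : nat) : formula REF_language 0 :=
  All (Ex (And
    (And (REF_atom k v1 v0) (Not (REF_atom k.+1 v1 v0)))
    (All (Imp (REF_atom k v2 v0)
              (Or (REF_atom k.+1 v2 v0) (REF_atom k.+1 v1 v0)))))).

Definition REFbin : theory REF_language :=
  [set All (All (REF_atom 0 v1 v0))]
  `|` \bigcup_k equivalence_axioms (@REF_atom k)
  `|` range REF_refines
  `|` range REF_splits.

(* Main.v *)
(* A countable model of T_2 consists of nested equivalence relations E and F and
   a successor relation S whose orbits inside an F-class are copies of Z.  An
   F-class is determined by its number of orbits, an E-class by the number of its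
   F-classes of each size, and the whole model by the number of its E-classes of
   each type, so the model is determined by a countable set of reals: the codes
   of an E-class type together with its multiplicity.

   A model of REF(bin) with universe omega is a labelling of omega by a dense
   family of branches of the binary tree, up to automorphisms of the tree.  Put
   i + 1 labels on the branch given by the binary digits of i, for every i.  An
   isomorphism preserves the multiplicities of branches, hence fixes a dense set
   of branches, hence acts trivially on the tree.  Adding infinitely many labels
   on each branch of a countable set X of other branches thus gives a model which
   determines X. *)

From HB Require Import structures.
Require Import Defs.
From mathcomp Require Import all_boot all_order all_algebra all_classical.
From mathcomp Require Import measurable_structure topology.

Set Implicit Arguments.
Unset Strict Implicit.
Unset Printing Implicit Defensive.

Import Order.TTheory GRing.Theory Num.Theory.

Local Open Scope classical_set_scope.
Local Open Scope card_scope.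

(** * Satisfaction in a definable class *)

Section RelativizedSatisfaction.
Context {L : language} {U : Type}.

(** Only the quantifiers are restricted to [D], while the universe stays [U]. A class of a jump, and
    then a class inside that class, can thus be treated without a type of its own. *)
Fixpoint sat_in (D : set U) (M : structure L U) (n : nat) (p : formula L n) :
    n.-tuple U -> Prop :=
  match p in formula _ n return n.-tuple U -> Prop with
  | Bot _ => fun _ => False
  | Equal _ i j => fun v => tnth v i = tnth v j
  | Atom _ R a => fun v => holds M R (map_tuple (tnth v) a)
  | Imp _ p q => fun v => sat_in D M p v -> sat_in D M q v
  | And _ p q => fun v => sat_in D M p v /\ sat_in D M q v
  | Or _ p q => fun v => sat_in D M p v \/ sat_in D M q v
  | All _ p => fun v => forall x, D x -> sat_in D M p (cons_tuple x v)
  | Ex _ p => fun v => exists2 x, D x & sat_in D M p (cons_tuple x v)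
  end.

Definition models_in (D : set U) (M : structure L U) (T : theory L) : Prop :=
  forall p, T p -> sat_in D M p [tuple].

Lemma sat_inT (M : structure L U) n (p : formula L n) v :
  sat_in setT M p v <-> sat M p v.
Proof.
elim: n / p v => //= n.
- by move=> p IHp q IHq v; rewrite (propext (IHp v)) (propext (IHq v)).
- by move=> p IHp q IHq v; rewrite (propext (IHp v)) (propext (IHq v)).
- by move=> p IHp q IHq v; rewrite (propext (IHp v)) (propext (IHq v)).
- move=> p IHp v; split=> H x; first by apply/IHp/H.
  by move=> _; apply/IHp/H.
- move=> p IHp v; split=> [[x _]|[x]] /IHp; first by exists x.
  by exists x.
Qed.

Lemma models_inT (M : structure L U) T : models M T -> models_in setT M T.
Proof. by move=> MT p Tp; apply/sat_inT/MT. Qed.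

Lemma tnth_cons (x : U) n (v : n.-tuple U) i :
  tnth (cons_tuple x v) (lift ord0 i) = tnth v i.
Proof. by rewrite !(tnth_nth x). Qed.

Lemma sat_in_universal_closure D (M : structure L U) n (p : formula L n) :
  sat_in D M (universal_closure p) [tuple] <->
  forall v : n.-tuple U, (forall i, D (tnth v i)) -> sat_in D M p v.
Proof.
elim: n p => [|n IHn] p /=.
  split=> [H v _|H]; last by apply: H; case.
  by rewrite (tuple0 v).
rewrite (propext (IHn _)); split=> [H v Dv|H v Dv x Dx]; last first.
  apply: (H (cons_tuple x v)) => i.
  case: (unliftP ord0 i) => [j|] ->; last by rewrite tnth0.
  by rewrite tnth_cons.
rewrite (tuple_eta v); apply: (H (behead_tuple v)) => [i|]; last exact: Dv.
by rewrite tnth_behead.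
Qed.

End RelativizedSatisfaction.

(** * Models of a jump *)

Definition same_class {L : language} {U : Type}
    (M : structure (jump_language L) U) (x y : U) : Prop :=
  holds M (None : jump_language L) [tuple x; y].

Definition reduct {L : language} {U : Type}
    (M : structure (jump_language L) U) : structure L U :=
  fun Ra => holds M (Some (projT1 Ra) : jump_language L) (projT2 Ra).

Lemma map_tuple2 (T V : Type) (g : T -> V) x y :
  map_tuple g [tuple x; y] = [tuple g x; g y].
Proof. exact: val_inj. Qed.

Section Jump.
Context {L : language} {U : Type}.
Implicit Types (M : structure (jump_language L) U) (D : set U).

Lemma sat_in_class_atom D M n (v : n.-tuple U) i j :
  sat_in D M (class_atom n i j) v <-> same_class M (tnth v i) (tnth v j).
Proof. by rewrite /= map_tuple2. Qed.

(** Prepending a bound variable leaves the class parameter in last position, so all guards inserted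
    by [relativize] refer to the same class. The set [D] is arbitrary so that a second jump can be
    relativized inside a class of the first. *)
Lemma sat_in_relativize D M n (p : formula L n) (v : n.-tuple U)
    (w : n.+1.-tuple U) :
  (forall i, tnth w (widen_ord (leqnSn n) i) = tnth v i) ->
  sat_in D M (relativize p) w <->
  sat_in (D `&` same_class M (tnth w ord_max)) (reduct M) p v.
Proof.
have wcons n' (v' : n'.-tuple U) (w' : n'.+1.-tuple U) x :
    (forall i, tnth w' (widen_ord (leqnSn n') i) = tnth v' i) ->
    (forall i, tnth (cons_tuple x w') (widen_ord (leqnSn n'.+1) i) =
      tnth (cons_tuple x v') i).
  move=> vw i; case: (unliftP ord0 i) => [j|] ->; last first.
    by rewrite tnth0 !(tnth_nth x).
  by rewrite tnth_cons -vw !(tnth_nth x).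
have wmax n' (w' : n'.+1.-tuple U) x :
    tnth (cons_tuple x w') ord_max = tnth w' ord_max.
  by rewrite !(tnth_nth x).
elim: n / p v w => [n|n i j|n R a|n p IHp q IHq|n p IHp q IHq|n p IHp q IHq
  |n p IHp|n p IHp] v w vw; rewrite /sat_in -/sat_in //=.
- by rewrite !vw.
- rewrite /reduct /holds /=; suff -> : map_tuple (tnth w)
    (map_tuple (widen_ord (leqnSn n)) a) = map_tuple (tnth v) a by [].
  by apply: eq_from_tnth => i; rewrite !tnth_map.
- by rewrite (propext (IHp v w vw)) (propext (IHq v w vw)).
- by rewrite (propext (IHp v w vw)) (propext (IHq v w vw)).
- by rewrite (propext (IHp v w vw)) (propext (IHq v w vw)).
- have IH x := IHp _ _ (wcons _ _ _ x vw).
  split=> [H x [Dx cx]|H x Dx].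
    rewrite -(wmax _ w x); apply/IH/H => //.
    by rewrite map_tuple2 wmax tnth0.
  rewrite map_tuple2 wmax tnth0 => cx.
  by apply/IH; rewrite wmax; apply: H.
- have IH x := IHp _ _ (wcons _ _ _ x vw).
  split=> [[x Dx]|[x [Dx cx] H]].
    rewrite map_tuple2 wmax tnth0 => -[cx /IH].
    by rewrite wmax; exists x.
  exists x => //; split; first by rewrite map_tuple2 wmax tnth0.
  by apply/IH; rewrite wmax.
Qed.

(** Being relative to [D], this applies first to the whole universe and then inside each class of
    the outer jump. *)
Lemma models_in_jump D M (T : theory L) : models_in D M (jump T) ->
  [/\ [/\ forall x, D x -> same_class M x x,
          forall x y, D x -> D y -> same_class M x y -> same_class M y x &
          forall x y z, D x -> D y -> D z ->
            same_class M x y -> same_class M y z -> same_class M x z],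
      forall x, D x -> models_in (D `&` same_class M x) (reduct M) T &
      forall (R : L) (a : (arity R).-tuple U) i j, (forall k, D (tnth a k)) ->
        holds (reduct M) R a -> same_class M (tnth a i) (tnth a j)].
Proof.
move=> DM; split; first split.
- move=> x Dx; have /DM /(_ x Dx) : jump T (All (class_atom _ v0 v0)).
    by left; left; left; left; left.
  by move=> /sat_in_class_atom; apply.
- move=> x y Dx Dy.
  have /DM /(_ y Dy x Dx) : jump T
    (All (All (Imp (class_atom 2 v0 v1) (class_atom 2 v1 v0)))).
    by left; left; left; left; right.
  by rewrite /= !map_tuple2; apply.
- move=> x y z Dx Dy Dz.
  have /DM /(_ z Dz y Dy x Dx) : jump T
    (All (All (All (Imp (And (class_atom 3 v0 v1) (class_atom 3 v1 v2))
                        (class_atom 3 v0 v2))))).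
    by left; left; left; right.
  by rewrite /= !map_tuple2 => H xy yz; apply: H.
- move=> x Dx p Tp.
  have /DM /(_ x Dx) : jump T (All (relativize p)) by left; right; exists p.
  have vw (i : 'I_0) :
    tnth (cons_tuple x [tuple]) (widen_ord (leqnSn 0) i) = tnth [tuple] i.
    by case: i.
  by move/(proj1 (sat_in_relativize D M p vw)); apply.
- move=> R a i j Da aR; have /DM : jump T (local_atom i j).
    by right; exists R, i, j.
  move/sat_in_universal_closure => /(_ a Da); rewrite /= map_tuple2.
  apply; suff -> : map_tuple (tnth a) (ord_tuple (arity R)) = a by [].
  by apply: eq_from_tnth => k; rewrite tnth_map tnth_ord_tuple.
Qed.

End Jump.

(** * First-order consequences of the theory of the integers with successor *)

Definition succ_atom {n : nat} (i j : 'I_n) : formula succ_language n :=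
  @Atom succ_language n tt [tuple i; j].

Definition succ_rel {U : Type} (M : structure succ_language U) (x y : U) : Prop :=
  holds M (tt : succ_language) [tuple x; y].

Fixpoint steps {U : Type} (D : set U) (S : U -> U -> Prop) (n : nat)
    (x y : U) : Prop :=
  if n is n'.+1 then exists2 z, D z & S x z /\ steps D S n' z y else x = y.

Fixpoint steps_formula (n k : nat) (i j : 'I_k) : formula succ_language k :=
  if n is n'.+1 then
    Ex (And (succ_atom (lift ord0 i) v0) (steps_formula n' v0 (lift ord0 j)))
  else Equal i j.

Lemma sat_in_steps (U : Type) (D : set U) (M : structure succ_language U)
    n k (i j : 'I_k) (v : k.-tuple U) :
  sat_in D M (steps_formula n i j) v <->
  steps D (succ_rel M) n (tnth v i) (tnth v j).
Proof.
elim: n k i j v => [|n IHn] k i j v //=.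
split=> -[x Dx [ix xj]]; exists x => //; split.
- by move: ix; rewrite map_tuple2 tnth_cons tnth0.
- by move/IHn: xj; rewrite tnth_cons tnth0.
- by rewrite map_tuple2 tnth_cons tnth0.
- by apply/IHn; rewrite tnth_cons tnth0.
Qed.

Lemma int_steps n x y :
  steps setT (succ_rel int_succ) n x y -> y = (x + n%:Z)%R.
Proof.
elim: n x => [|n IHn] x /=; first by rewrite addr0.
move=> [z _ [/eqP xz /IHn ->]].
have -> : z = (x + 1)%R by rewrite -xz.
by rewrite -addrA -intS.
Qed.

(** This amounts to [D] being a disjoint union of copies of the integers: [S] is the graph of a
    permutation of [D] without finite cycles. The last clause is a scheme, with one first-order
    sentence for each length. *)
Definition succ_axioms {U : Type} (D : set U) (S : U -> U -> Prop) : Prop :=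
  [/\ forall x, D x -> exists2 y, D y & S x y,
      forall y, D y -> exists2 x, D x & S x y,
      forall x y z, D x -> D y -> D z -> S x y -> S x z -> y = z,
      forall x y z, D x -> D y -> D z -> S x z -> S y z -> x = y &
      forall n x, D x -> ~ steps D S n.+1 x x].

Lemma T0_succ_axioms (U : Type) (D : set U) (M : structure succ_language U) :
  models_in D M T0 -> succ_axioms D (succ_rel M).
Proof.
move=> DM; split.
- move=> x Dx.
  have /DM /(_ x Dx) /= [y Dy] : T0 (All (Ex (succ_atom v1 v0))).
    move=> x'; exists (x' + 1)%R; rewrite /= map_tuple2; exact/eqP.
  by rewrite map_tuple2; exists y.
- move=> y Dy.
  have /DM /(_ y Dy) /= [x Dx] : T0 (All (Ex (succ_atom v0 v1))).
    move=> x'; exists (x' - 1)%R; rewrite /= map_tuple2; apply/eqP.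
    exact/esym/subrK.
  by rewrite map_tuple2; exists x.
- move=> x y z Dx Dy Dz.
  have /DM /(_ x Dx y Dy z Dz) /= : T0 (All (All (All
    (Imp (succ_atom v2 v1) (Imp (succ_atom v2 v0) (Equal v1 v0)))))).
    by move=> x' y' z' /=; rewrite !map_tuple2 => /eqP xy /eqP xz;
      exact: etrans xy (esym xz).
  by rewrite !map_tuple2; apply.
- move=> x y z Dx Dy Dz.
  have /DM /(_ x Dx y Dy z Dz) /= : T0 (All (All (All
    (Imp (succ_atom v2 v0) (Imp (succ_atom v1 v0) (Equal v2 v1)))))).
    move=> x' y' z' /=; rewrite !map_tuple2 => /eqP xz /eqP yz.
    exact: (addIr _ (etrans (esym xz) yz)).
  by rewrite !map_tuple2; apply.
- move=> n x Dx.
  have /DM /(_ x Dx) /= : T0 (All (Not (steps_formula n.+1 v0 v0))).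
    move=> x' xx; have /int_steps :=
      proj1 (sat_in_steps setT int_succ n.+1 v0 v0 [tuple x'])
        (proj2 (sat_inT int_succ (steps_formula n.+1 v0 v0) [tuple x']) xx).
    by rewrite -[X in X = _]addr0 => /addrI.
  move=> H xx; apply: H.
  exact: (proj2 (sat_in_steps D M n.+1 v0 v0 [tuple x]) xx).
Qed.

(** * Models of T_2 as nested relations *)

Notation T2_signature := (option (option unit)).

Definition T2_rel {U : Type}
    (M : structure (jump_language (jump_language succ_language)) U)
    (R : T2_signature) (x y : U) : Prop :=
  match R with
  | None => same_class M x y
  | Some None => same_class (reduct M) x y
  | Some (Some _) => succ_rel (reduct (reduct M)) x y
  end.

Definition equivalence {U : Type} (E : U -> U -> Prop) : Prop :=
  [/\ forall x, E x x, forall x y, E x y -> E y x &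
      forall x y z, E x y -> E y z -> E x z].

Definition nested {U : Type} (R : T2_signature -> U -> U -> Prop) : Prop :=
  [/\ equivalence (R None), equivalence (R (Some None)),
      forall x y, R (Some None) x y -> R None x y,
      forall x y, R (Some (Some tt)) x y -> R (Some None) x y &
      succ_axioms setT (R (Some (Some tt)))].

(** The theory describes F only inside each E-class, and S only inside each F-class. The locality
    axioms put F inside E and S inside F, so no related pair escapes these descriptions and they
    hold on the whole universe. *)
Lemma T2_nested (U : Type)
    (M : structure (jump_language (jump_language succ_language)) U) :
  models M T2 -> nested (T2_rel M).
Proof.
move=> /models_inT /models_in_jump [[Er Es Et] MT1 Floc].
have eqE : equivalence (same_class M).
  split; [exact: (fun x => Er x I)|exact: (fun x y => Es x y I I)|].
  exact: (fun x y z => Et x y z I I I).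
have FE x y : same_class (reduct M) x y -> same_class M x y.
  by move=> /(Floc None [tuple x; y] v0 v1); apply.
have SE x y : succ_rel (reduct (reduct M)) x y -> same_class M x y.
  by move=> /(Floc (Some tt) [tuple x; y] v0 v1); apply.
have {}MT1 x := models_in_jump (MT1 x I).
have [{}Er {}Es {}Et] := eqE.
have eqF : equivalence (same_class (reduct M)).
  split.
  - by move=> x; have [[Fr _ _] _ _] := MT1 x; apply: Fr.
  - move=> x y xy; have [[_ Fs _] _ _] := MT1 x.
    by apply: Fs => //; split=> //; exact: FE.
  - move=> x y z xy yz; have [[_ _ Ft] _ _] := MT1 x.
    have xEy := FE _ _ xy; have yEz := FE _ _ yz.
    apply: (Ft x y z) => //; split=> //; exact: (Et x y z).
have [Fr Fs Ft] := eqF.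
have SF x y : succ_rel (reduct (reduct M)) x y -> same_class (reduct M) x y.
  move=> xy; have [_ _ Sloc] := MT1 x.
  apply: (Sloc tt [tuple x; y] v0 v1) => // k; split => //.
  case: (unliftP ord0 k) => [j|] ->; last exact: Er.
  by rewrite ord1; apply: SE.
have ST x : succ_axioms (setT `&` same_class M x `&` same_class (reduct M) x)
    (succ_rel (reduct (reduct M))).
  have [_ H _] := MT1 x; apply: T0_succ_axioms; apply: H.
  by split=> //; apply: Er.
have inD x y : same_class (reduct M) x y ->
    (setT `&` same_class M x `&` same_class (reduct M) x) y.
  by move=> xy; split=> //; split=> //; exact: FE.
split=> //; split.
- move=> x _; have [H _ _ _ _] := ST x.
  by have [y _ xy] := H x (inD _ _ (Fr x)); exists y.
- move=> x _; have [_ H _ _ _] := ST x.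
  by have [y _ xy] := H x (inD _ _ (Fr x)); exists y.
- move=> x y z _ _ _ xy xz; have [_ _ H _ _] := ST x.
  by apply: (H x y z) => //; apply: inD => //; exact: SF.
- move=> x y z _ _ _ xz yz; have [_ _ _ H _] := ST z.
  by apply: (H x y z) => //; apply: inD => //; apply: Fs; exact: SF.
- move=> n x _ xx; have [_ _ _ _ H] := ST x.
  apply: (H n x); first exact: inD.
  (* A cycle through [x] never leaves the F-class of [x], because S is included in F, so acyclicity
     inside that class excludes it. *)
  suff: forall m y, same_class (reduct M) x y ->
      steps setT (succ_rel (reduct (reduct M))) m y x ->
      steps (setT `&` same_class M x `&` same_class (reduct M) x)
        (succ_rel (reduct (reduct M))) m y x by apply.
  elim=> [|m IHm] y xFy //= [z _ [yz zx]].
  have xFz : same_class (reduct M) x z by apply: (Ft _ _ _ xFy); exact: SF.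
  by exists z; [exact: inD|split=> //; exact: IHm].
Qed.

(** * Counting and matching classes *)

Section ClassCounting.

(** At least [n] classes of [E] meet [A]. A witness is a finite sequence, hence an element of a
    countable type, which later makes the counts Borel. *)
Definition many (E : nat -> nat -> Prop) (A : set nat) (n : nat) : Prop :=
  exists s : seq nat, [/\ size s = n, uniq s, forall x, x \in s -> A x &
    forall x y, x \in s -> y \in s -> E x y -> x = y].

Definition reps (E : nat -> nat -> Prop) (A : set nat) : set nat :=
  [set x | A x /\ forall y, A y -> E y x -> (x <= y)%N].

Lemma many0 E A : many E A 0.
Proof. by exists [::]. Qed.

Lemma many_leq E A m n : (m <= n)%N -> many E A n -> many E A m.
Proof.
move=> mn [s [sn us sA sE]]; exists (take m s).
have sub x : x \in take m s -> x \in s by apply: mem_take.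
split; first by rewrite size_takel // sn.
- exact: take_uniq.
- by move=> x /sub /sA.
- by move=> x y /sub xs /sub ys; apply: sE.
Qed.

Lemma many_sub E F A B (g : nat -> nat) n : injective g ->
  (forall x, A x -> B (g x)) -> (forall x y, F (g x) (g y) -> E x y) ->
  many E A n -> many F B n.
Proof.
move=> g_inj AB FE [s [sn us sA sE]]; exists (map g s); split.
- by rewrite size_map.
- by rewrite map_inj_uniq.
- by move=> _ /mapP[x /sA Ax ->]; apply: AB.
- by move=> _ _ /mapP[x xs ->] /mapP[y ys ->] /FE /(sE _ _ xs ys) ->.
Qed.

Lemma many_bij E F A B (g : nat -> nat) n : bijective g ->
  (forall x, A x <-> B (g x)) -> (forall x y, E x y <-> F (g x) (g y)) ->
  many E A n <-> many F B n.
Proof.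
move=> [h gK hK] AB EF; split.
  apply: (many_sub (g := g)); first exact: can_inj gK.
    by move=> x /AB.
  by move=> x y /EF.
apply: (many_sub (g := h)); first exact: can_inj hK.
  by move=> x Bx; apply/AB; rewrite hK.
by move=> x y /EF; rewrite !hK.
Qed.

Lemma many_eq E A B n : (forall x, A x <-> B x) -> many E A n <-> many E B n.
Proof. by move=> AB; apply: (many_bij (g := id)) => //; exists id. Qed.

Section Representatives.
Variables (E : nat -> nat -> Prop) (A : set nat).
Hypothesis eqE : equivalence E.

Lemma reps_ex x : A x -> exists2 r, reps E A r & E r x.
Proof.
have [Er Es Et] := eqE => Ax.
have ex_r : exists r, `[< A r /\ E r x >] by exists x; apply/asboolP.
case: (ex_minnP ex_r) => r /asboolP[Ar rx] r_min; exists r => //.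
split=> // y Ay yr; apply: r_min; apply/asboolP; split=> //.
exact: Et yr rx.
Qed.

Lemma reps_inj r r' : reps E A r -> reps E A r' -> E r r' -> r = r'.
Proof.
have [_ Es _] := eqE; move=> [Ar r_min] [Ar' r'_min] rr'.
by apply/eqP; rewrite eqn_leq r_min ?r'_min //; apply: Es.
Qed.

(** Replacing the members of a witness by their representatives keeps them distinct, so the finite
    counts measure the transversal [reps E A]. *)
Lemma many_reps n : many E A n <-> `I_n #<= reps E A.
Proof.
have [Er Es Et] := eqE; split.
  move=> [s [sn us sA sE]].
  have /choice[r rP] x : exists r, A x -> reps E A r /\ E r x.
    have [Ax|nAx] := pselect (A x); last by exists 0.
    by have [r rA rx] := reps_ex Ax; exists r.
  apply/pcard_leP/injfunPex; exists (fun k => r (nth 0 s k)) => [k /= kn|].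
    by have [] := rP (nth 0 s k) _; first by apply/sA/mem_nth; rewrite sn.
  move=> k l /set_mem /= kn /set_mem /= ln rkl.
  have ks : nth 0 s k \in s by rewrite mem_nth ?sn.
  have ls : nth 0 s l \in s by rewrite mem_nth ?sn.
  have [_ rk] := rP _ (sA _ ks); have [_ rl] := rP _ (sA _ ls).
  have /(sE _ _ ks ls) : E (nth 0 s k) (nth 0 s l).
    by apply: (Et _ _ _ (Es _ _ rk)); rewrite rkl.
  by move/eqP; rewrite nth_uniq ?sn // => /eqP.
move=> /pcard_leP/injfunPex[f fA f_inj]; exists (map f (iota 0 n)).
have fin k : k \in iota 0 n -> `I_n k by rewrite mem_iota.
split; first by rewrite size_map size_iota.
- rewrite map_inj_in_uniq ?iota_uniq // => k l /fin kn /fin ln.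
  by apply: f_inj; apply: mem_set.
- by move=> _ /mapP[k /fin kn ->]; have [] := fA k kn.
- move=> _ _ /mapP[k /fin kn ->] /mapP[l /fin ln ->].
  by apply: reps_inj; apply: fA.
Qed.

End Representatives.

(** A set of naturals is finite or countably infinite, so the finite cardinals below it determine
    its cardinality. *)
Lemma card_eq_initial (P Q : set nat) :
  (forall n, `I_n #<= P <-> `I_n #<= Q) -> P #= Q.
Proof.
have fin (A B : set nat) :
    (forall n, `I_n #<= A -> `I_n #<= B) -> finite_set B -> finite_set A.
  move=> AB [m /card_eqPle[Bm _]]; apply: contrapT => /infiniteP infA.
  have /AB /card_le_trans /(_ Bm) : `I_m.+1 #<= A.
    by apply: card_le_trans infA; apply: subset_card_le.
  by rewrite card_le_II ltnn.
move=> PQ; have [finP|infP] := pselect (finite_set P).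
  have finQ : finite_set Q by apply: fin finP => n /PQ.
  have [[n Pn] [m Qm]] := (finP, finQ).
  have /card_eqPle[Pn1 Pn2] := Pn; have /card_eqPle[Qm1 Qm2] := Qm.
  have nm : (n <= m)%N by rewrite -card_le_II; apply: card_le_trans Qm1; apply/PQ.
  have mn : (m <= n)%N by rewrite -card_le_II; apply: card_le_trans Pn1; apply/PQ.
  have nEm : n = m by apply/eqP; rewrite eqn_leq nm mn.
  by apply: card_eq_trans Pn _; rewrite nEm; apply: card_esym.
have infQ : ~ finite_set Q by move=> finQ; apply: infP; apply: fin finQ => n /PQ.
apply: (card_eq_trans (B := [set: nat])); first exact: eq_card_nat.
by apply: card_esym; apply: eq_card_nat.
Qed.

End ClassCounting.

(** Bijections chosen fibre by fibre combine, since the fibres partition both sets. *)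
Lemma set_bij_fibers (T U : pointedType) (I : Type) (A : set T) (B : set U)
    (f : T -> I) (g : U -> I) :
  (forall i, [set x | A x /\ f x = i] #= [set y | B y /\ g y = i]) ->
  exists2 h, set_bij A B h & forall x, A x -> g (h x) = f x.
Proof.
move=> fg; have /choice[h hP] i : exists h,
    set_bij [set x | A x /\ f x = i] [set y | B y /\ g y = i] h.
  exact/card_set_bijP.
exists (fun x => h (f x) x) => [|x Ax]; last first.
  by have [hfun _ _] := hP (f x); have [] := hfun x.
split.
- by move=> x Ax; have [hfun _ _] := hP (f x); have [] := hfun x.
- move=> x y /set_mem Ax /set_mem Ay hxy.
  have [hx _ _] := hP (f x); have [hy h_inj _] := hP (f y).
  have [[_ gx] [_ gy]] := (hx x (conj Ax erefl), hy y (conj Ay erefl)).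
  have fxy : f x = f y by rewrite -gx -gy hxy.
  apply: h_inj; try exact: mem_set.
  by rewrite -{1}fxy.
- move=> y By; have [_ _ hsurj] := hP (g y).
  by have [x [Ax fx] hx] := hsurj y (conj By erefl); exists x => //; rewrite fx.
Qed.

(** * Gluing isomorphisms of classes *)

Section Gluing.

Definition partial_iso {J : Type} (R R' : J -> nat -> nat -> Prop)
    (A B : set nat) : Prop :=
  exists2 g, set_bij A B g &
    forall j x y, A x -> A y -> (R j x y <-> R' j (g x) (g y)).

Variables (J I : Type) (R R' : J -> nat -> nat -> Prop).
Variables (E F : nat -> nat -> Prop) (A B : set nat) (t u : nat -> I).
Hypotheses (eqE : equivalence E) (eqF : equivalence F).
Hypothesis EA : forall x y, A x -> E x y -> A y /\ t x = t y.
Hypothesis FB : forall x y, B x -> F x y -> B y /\ u x = u y.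
Hypothesis same_count : forall i n,
  many E [set x | A x /\ t x = i] n <-> many F [set y | B y /\ u y = i] n.
Hypothesis class_iso : forall x y, A x -> B y -> t x = u y ->
  partial_iso R R' [set z | E x z] [set z | F y z].
Hypothesis across : forall j x y x' y', A x -> A y -> B x' -> B y' ->
  ~ E x y -> ~ F x' y' -> (R j x y <-> R' j x' y').

Let reps_type (K : nat -> nat -> Prop) (C : set nat) (v : nat -> I) :
  equivalence K -> (forall x y, C x -> K x y -> C y /\ v x = v y) ->
  forall i, reps K [set x | C x /\ v x = i] = [set x | reps K C x /\ v x = i].
Proof.
move=> [Kr Ks Kt] KC i; apply/seteqP; split=> x /=.
  move=> [[Cx vx] x_min]; do 2?split=> //; move=> y Cy yx; apply: x_min => //.
  by split=> //; have [_ ->] := KC _ _ Cy yx.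
by move=> [[Cx x_min] vx]; do 2?split=> //; move=> y [Cy _]; apply: x_min.
Qed.

(** By [same_count] the representatives are matched by a bijection that respects types. Isomorphisms
    between matched classes are then pasted together, and [across] settles pairs from different
    classes. The lemma serves three levels: chains in an F-class, F-classes in an E-class, E-classes
    in the universe. *)
Lemma glue_partial_iso : partial_iso R R' A B.
Proof.
have [[Er Es Et] [Fr Fs Ft]] := (eqE, eqF).
have [|h [hfun h_inj hsurj] ht] :=
  @set_bij_fibers nat nat I (reps E A) (reps F B) t u.
  move=> i; rewrite -!reps_type //; apply: card_eq_initial => n.
  rewrite -(propext (many_reps _ eqE n)) -(propext (many_reps _ eqF n)).
  exact: same_count.
have /choice[r rP] x : exists r, A x -> reps E A r /\ E r x.
  have [Ax|nAx] := pselect (A x); last by exists 0.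
  by have [r rA rx] := reps_ex eqE Ax; exists r.
have /choice[G GP] x : exists g, reps E A x ->
    set_bij [set z | E x z] [set z | F (h x) z] g /\
    forall j y z, E x y -> E x z -> (R j y z <-> R' j (g y) (g z)).
  have [Ax|nAx] := pselect (reps E A x); last by exists id.
  have [|||g gbij gR] := class_iso (x := x) (y := h x); last by exists g.
  - by case: Ax.
  - by have [] := hfun x Ax.
  - by rewrite ht.
pose g x := G (r x) x.
have gF x : A x -> F (h (r x)) (g x).
  by move=> Ax; have [rA rx] := rP x Ax; have [[Gfun _ _] _] := GP _ rA; apply: Gfun.
have hB x : A x -> B (h (r x)).
  by move=> Ax; have [rA rx] := rP x Ax; have [] := hfun _ rA.
have gB x : A x -> B (g x).
  by move=> Ax; have [] := FB (hB x Ax) (gF x Ax).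
have r_eq x y : A x -> A y -> (E x y <-> r x = r y).
  move=> Ax Ay; have [[rAx rx] [rAy ry]] := (rP x Ax, rP y Ay).
  split=> [xy|rxy]; last by apply: (Et _ _ _ (Es _ _ rx)); rewrite rxy.
  apply: (reps_inj eqE rAx rAy); apply: (Et _ _ _ rx).
  by apply: (Et _ _ _ xy); apply: Es.
(* As [h] is injective on representatives, points of different classes have images in different
   classes. Both the injectivity of [g] and the use of [across] rest on this. *)
have gEF x y : A x -> A y -> F (g x) (g y) -> r x = r y.
  move=> Ax Ay Fxy; have [[rAx rx] [rAy ry]] := (rP x Ax, rP y Ay).
  apply: h_inj; try exact: mem_set.
  apply: (reps_inj eqF); try exact: hfun.
  apply: (Ft _ _ _ (gF x Ax)); apply: (Ft _ _ _ Fxy).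
  by apply: Fs; apply: gF.
exists g; first split.
- exact: gB.
- move=> x y /set_mem Ax /set_mem Ay gxy.
  have rxy : r x = r y by apply: gEF => //; rewrite gxy.
  have [[rAx rx] [rAy ry]] := (rP x Ax, rP y Ay).
  have [[_ G_inj _] _] := GP _ rAx.
  apply: G_inj; [exact: mem_set|by apply: mem_set; rewrite /= rxy|].
  by move: gxy; rewrite /g rxy.
- move=> y By; have [s sB sy] := reps_ex eqF By.
  have [x xA hx] := hsurj _ sB.
  have [[_ _ Gsurj] _] := GP _ xA.
  have [|z xz Gz] := Gsurj y; first by rewrite /= hx.
  have Ax : A x by case: xA.
  have [Az _] := EA Ax xz.
  exists z => //; rewrite /g; suff <- : x = r z by [].
  have [rA rz] := rP z Az.
  by apply: (reps_inj eqE xA rA); apply: (Et x z) => //; apply: Es.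
- move=> j x y Ax Ay; have [[rAx rx] [rAy ry]] := (rP x Ax, rP y Ay).
  have [rxy|nrxy] := pselect (r x = r y).
    have [_ GR] := GP _ rAx.
    by rewrite /g -rxy; apply: GR => //; rewrite rxy.
  apply: (across _ Ax Ay (gB x Ax) (gB y Ay)).
    by move=> /(r_eq x y Ax Ay).
  by move=> /(gEF x y Ax Ay).
Qed.

End Gluing.

(** * Isomorphism invariants of models of T_2 *)

Definition chain (S : nat -> nat -> Prop) (x y : nat) : Prop :=
  exists n, steps setT S n x y \/ steps setT S n y x.

Section Orbits.
Variable S : nat -> nat -> Prop.
Hypothesis axS : succ_axioms setT S.

(** The successor and predecessor maps are mutually inverse and thus give an action of the integers
    whose orbits are the chains. Acyclicity makes the action free. *)
Lemma chain_enum : exists e : nat -> int -> nat,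
  [/\ forall x, e x 0%R = x, forall x z w, e (e x z) w = e x (z + w)%R,
      forall x, injective (e x),
      forall x z w, S (e x z) (e x w) <-> w = (z + 1)%R &
      forall x y, chain S x y <-> exists z, e x z = y].
Proof.
have [Stot Ssurj Sfun Sinj Sacyclic] := axS.
have /choice[s sP] x : exists y, S x y by have [y _ xy] := Stot x I; exists y.
have /choice[p pP] y : exists x, S x y by have [x _ xy] := Ssurj y I; exists x.
have sK x : p (s x) = x by apply: (Sinj _ _ (s x)).
have pK x : s (p x) = x by apply: (Sfun (p x)).
(* [Negz n] stands for -(n + 1), whence the extra iteration of [p]. *)
pose e x z := match z with Posz n => iter n s x | Negz n => iter n.+1 p x end.
have eS x z : e x (z + 1)%R = s (e x z).
  case: z => n; first by rewrite addrC -intS.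
  case: n => [|n]; first by rewrite /= pK.
  have -> : (Negz n.+1 + 1 = Negz n)%R.
    by rewrite !NegzE (intS n.+1) opprD addrAC addNr add0r.
  by rewrite /= pK.
have eP x z : e x (z - 1)%R = p (e x z) by rewrite -(sK (e x _)) -eS subrK.
have eD x z w : e (e x z) w = e x (z + w)%R.
  elim/int_rect: w => [|n IHn|n IHn]; first by rewrite addr0.
    by rewrite intS [(1 + _)%R]addrC eS IHn addrA eS.
  by rewrite intS opprD [(- 1 + _)%R]addrC eP IHn addrA eP.
have e_steps x n : steps setT S n x (e x (Posz n)).
  elim: n x => [|n IHn] x //=; exists (s x) => //; split=> //.
  by rewrite -iterS iterSr; apply: IHn.
have steps_e n x y : steps setT S n x y -> e x (Posz n) = y.
  elim: n x => [|n IHn] x //= [z _ [xz zy]].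
  by rewrite -iterS iterSr (Sfun x (s x) z) //; apply: IHn.
have e_inj x : injective (e x).
  have e_neq z n : e x z = e x (z + (Posz n.+1))%R -> False.
    move=> exz; apply: (Sacyclic n (e x z)) => //.
    by rewrite {2}exz -eD; apply: e_steps.
  have gap z w : (z < w)%R -> exists n, w = (z + Posz n.+1)%R.
    rewrite -subr_gt0; case wz: (w - z)%R => [[|n]|n] // _.
    by exists n; rewrite -wz addrC subrK.
  move=> z w ezw; have [/gap[n wE]|/gap[n zE]|//] := ltrgtP z w.
    by case: (e_neq z n); rewrite -wE.
  by case: (e_neq w n); rewrite -zE.
exists e; split=> //.
- move=> x z w; split=> [ezw|->]; last by rewrite eS.
  by apply: (e_inj x); rewrite eS; apply: (Sfun (e x z)).
- move=> x y; split=> [[n [/steps_e <-|/steps_e <-]]|[z <-]].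
  + by exists (Posz n).
  + by exists (- (Posz n))%R; rewrite eD subrr.
  + have [n [->|->]] : exists n, z = (Posz n) \/ z = (- (Posz n))%R.
    * by case: z => n; [exists n; left|exists n.+1; right; rewrite NegzE].
    * by exists n; left.
    * exists n; right; have := e_steps (e x (- (Posz n))%R) n.
      by rewrite eD addNr.
Qed.

Lemma chain_equivalence : equivalence (chain S).
Proof.
have [e [e0 eD e_inj eS eP]] := chain_enum; split.
- by move=> x; exists 0; left.
- by move=> x y [n [?|?]]; exists n; [right|left].
- by move=> x y z /eP[k <-] /eP[l <-]; apply/eP; exists (k + l)%R; rewrite eD.
Qed.

End Orbits.

Section Invariants.
Variable R : T2_signature -> nat -> nat -> Prop.
Local Notation E := (R None).
Local Notation F := (R (Some None)).
Local Notation S := (R (Some (Some tt))).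

Definition many_chains (x n : nat) : Prop := many (chain S) [set y | F x y] n.

(* The number of chains of the F-class of x is k, where 0 stands for infinity. *)
Definition chain_count (x k : nat) : Prop :=
  if k is k'.+1 then many_chains x k /\ ~ many_chains x k'.+2
  else forall n, many_chains x n.

Definition many_blocks (x k n : nat) : Prop :=
  many F [set y | E x y /\ chain_count y k] n.

Definition same_blocks (x y : nat) : Prop :=
  forall k n, many_blocks x k n <-> many_blocks y k n.

Definition many_copies (x n : nat) : Prop := many E [set y | same_blocks x y] n.

(** Each bit is the truth value of one lower bound, and the lower bounds together fix every number,
    infinity included. The second kind of bit records the multiplicity of the type, which the range
    of the codes would otherwise lose. Indices that decode to nothing carry false. *)
Definition class_code (x : nat) : nat -> bool := fun m =>
  match unpickle m : option (nat * nat + nat) with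
  | Some (inl (k, n)) => `[< many_blocks x k n >]
  | Some (inr n) => `[< many_copies x n >]
  | None => false
  end.

Hypothesis nestedR : nested R.

Lemma chain_block x y : chain S x y -> F x y.
Proof.
have [_ [Fr Fs Ft] FE SF _] := nestedR.
have stepsF n : forall x' y', steps setT S n x' y' -> F x' y'.
  elim: n => [|n IHn] x' y' /=; first by move=> ->.
  by move=> [z _ [/SF x'z /IHn zy']]; apply: Ft x'z zy'.
by case=> n [/stepsF //|/stepsF/Fs].
Qed.

Lemma chain_count_unique x k l : chain_count x k -> chain_count x l -> k = l.
Proof.
have lt k' l' : many_chains x l'.+1 -> ~ many_chains x k'.+2 -> (l' <= k')%N.
  move=> ml nk; rewrite leqNgt; apply/negP => kl; apply: nk.
  exact: many_leq ml.
case: k l => [|k] [|l] //=; first by move=> H [_ /(_ (H _))].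
  by move=> [_ H] /(_ k.+2).
move=> [mk nk] [ml nl]; congr _.+1; apply/eqP.
by rewrite eqn_leq !lt.
Qed.

Lemma chain_count_ex x : exists k, chain_count x k.
Proof.
have [Fr _ _] : equivalence F by case: nestedR.
have [inf|/existsNP ninf] := pselect (forall n, many_chains x n).
  by exists 0.
have ex_n : exists n, `[< ~ many_chains x n >].
  by have [n nn] := ninf; exists n; apply/asboolP.
(* The least failing bound is at least 2, as the chain of [x] itself is counted; the count is one
   less than this bound. *)
case: (ex_minnP ex_n) => [[|[|n]]] /asboolP nn n_min.
- by case: nn; apply: many0.
- case: nn; exists [:: x]; split=> //; first by move=> y; rewrite inE => /eqP ->.
  by move=> y z; rewrite !inE => /eqP -> /eqP ->.
- exists n.+1; split=> //; apply: contrapT => /asboolP /n_min.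
  by rewrite ltnn.
Qed.

Lemma chain_count_block x y k : F x y -> chain_count x k -> chain_count y k.
Proof.
have [_ [Fr Fs Ft] _ _ _] := nestedR => xy.
have eq n : many_chains x n <-> many_chains y n.
  apply: many_eq => z; split; first exact: (Ft _ _ _ (Fs _ _ xy)).
  exact: Ft xy.
case: k => [|k] /= H; first by move=> n; apply/eq.
by split; rewrite -(propext (eq _)); case: H.
Qed.

Lemma many_blocks_class x y k n : E x y -> many_blocks x k n <-> many_blocks y k n.
Proof.
have [[Er Es Et] _ _ _ _] := nestedR => xy.
apply: many_eq => z; split=> -[xz zk]; split=> //.
  exact: (Et _ _ _ (Es _ _ xy)).
exact: Et xy _.
Qed.

End Invariants.

(** The count determines all lower bounds: a finite count satisfies exactly those up to itself, and
    the value 0 satisfies all of them. *)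
Lemma chain_count_many R R' x x' k :
  chain_count R x k -> chain_count R' x' k ->
  forall n, many_chains R x n <-> many_chains R' x' n.
Proof.
case: k => [|k] /=; first by move=> H H' n; split.
have le Q y n : many_chains Q y k.+1 /\ ~ many_chains Q y k.+2 ->
    many_chains Q y n <-> (n <= k.+1)%N.
  move=> [mk nk]; split=> [mn|nk']; last exact: many_leq mk.
  by rewrite leqNgt; apply/negP => kn; apply: nk; apply: many_leq mn.
by move=> /le H /le H' n; rewrite (propext (H n)) (propext (H' n)).
Qed.

(** * Invariance and completeness of the codes *)

Section Isomorphism.
Variables R R' : T2_signature -> nat -> nat -> Prop.

Section Invariance.
Variable g : nat -> nat.
Hypotheses (g_bij : bijective g)
  (gR : forall j x y, R j x y <-> R' j (g x) (g y)).

Lemma steps_iso n x y : steps setT (R (Some (Some tt))) n x y <->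
  steps setT (R' (Some (Some tt))) n (g x) (g y).
Proof.
have [h gK hK] := g_bij.
elim: n x => [|n IHn] x /=; first by split=> [->//|/(can_inj gK)].
split=> -[z _ [xz zy]].
  by exists (g z) => //; split; [apply/gR|apply/IHn].
by exists (h z) => //; split; [apply/gR|apply/IHn]; rewrite hK.
Qed.

Lemma chain_iso x y : chain (R (Some (Some tt))) x y <->
  chain (R' (Some (Some tt))) (g x) (g y).
Proof.
by split=> -[n H]; exists n; move: H; rewrite !(propext (steps_iso _ _ _)).
Qed.

Lemma many_chains_iso x n : many_chains R x n <-> many_chains R' (g x) n.
Proof. by apply: many_bij g_bij _ chain_iso => y; apply: gR. Qed.

Lemma chain_count_iso x k : chain_count R x k <-> chain_count R' (g x) k.
Proof.
have H n := propext (many_chains_iso x n).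
by case: k => [|k] /=; [split=> K n; move: (K n)|]; rewrite !H.
Qed.

Lemma many_blocks_iso x k n : many_blocks R x k n <-> many_blocks R' (g x) k n.
Proof.
apply: many_bij g_bij _ (gR _) => y /=.
by rewrite (propext (gR _ _ _)) (propext (chain_count_iso _ _)).
Qed.

Lemma same_blocks_iso x y : same_blocks R x y <-> same_blocks R' (g x) (g y).
Proof.
split=> H k n; move: (H k n); by rewrite !(propext (many_blocks_iso _ _ _)).
Qed.

Lemma many_copies_iso x n : many_copies R x n <-> many_copies R' (g x) n.
Proof. by apply: many_bij g_bij _ (gR _) => y; apply: same_blocks_iso. Qed.

Lemma class_code_iso x : class_code R x = class_code R' (g x).
Proof.
apply/funext => m; rewrite /class_code; case: unpickle => // -[[k n]|n].
  by apply: asbool_equiv_eq; apply: many_blocks_iso.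
by apply: asbool_equiv_eq; apply: many_copies_iso.
Qed.

End Invariance.

Hypotheses (nestedR : nested R) (nestedR' : nested R').

(** Points at the same integer distance from [x] and from [y] correspond. Both equivalence relations
    hold throughout a chain, so only S has to be compared. *)
Lemma chain_partial_iso x y : partial_iso R R'
  [set z | chain (R (Some (Some tt))) x z] [set z | chain (R' (Some (Some tt))) y z].
Proof.
have [[Er Es Et] [Fr Fs Ft] FE SF axS] := nestedR.
have [[E'r E's E't] [F'r F's F't] FE' SF' axS'] := nestedR'.
have [e [e0 eD e_inj eS eP]] := chain_enum axS.
have [e' [e'0 e'D e'_inj e'S e'P]] := chain_enum axS'.
(* The coordinate of a point along the chain; points outside the chain get the arbitrary value 0. *)
have /choice[k kP] z : exists k, chain (R (Some (Some tt))) x z -> e x k = z.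
  have [/eP[k <-]|nz] := pselect (chain (R (Some (Some tt))) x z).
    by exists k.
  by exists 0%R.
have chF z w : chain (R (Some (Some tt))) x z -> chain (R (Some (Some tt))) x w ->
    R (Some None) z w.
  by move=> /(chain_block nestedR)/Fs zx /(chain_block nestedR); apply: Ft.
have chF' k' l' : R' (Some None) (e' y k') (e' y l').
  apply: (F't _ y); [apply: F's|]; apply: (chain_block nestedR'); apply/e'P.
    by exists k'.
  by exists l'.
exists (fun z => e' y (k z)); first split.
- by move=> z _; apply/e'P; exists (k z).
- move=> z w /set_mem /kP {2}<- /set_mem /kP {2}<- /e'_inj -> //.
- move=> z /e'P[l <-]; have xl : chain (R (Some (Some tt))) x (e x l).
    by apply/eP; exists l.
  by exists (e x l) => //; congr e'; apply: (e_inj x); apply: kP.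
- move=> [[[]|]|] z w xz xw.
  + by rewrite (propext (e'S _ _ _))
      -{1}(kP z xz) -{1}(kP w xw) (propext (eS _ _ _)).
  + by split=> _ //; apply: chF.
  + by split=> _; [apply: FE'|apply: FE; apply: chF].
Qed.

(** Any two chains are isomorphic, so a single type, taken in [unit], suffices for gluing and only
    the number of chains matters. *)
Lemma block_partial_iso x y k : chain_count R x k -> chain_count R' y k ->
  partial_iso R R' [set z | R (Some None) x z] [set z | R' (Some None) y z].
Proof.
have [[Er Es Et] [Fr Fs Ft] FE SF axS] := nestedR.
have [[E'r E's E't] [F'r F's F't] FE' SF' axS'] := nestedR'.
move=> xk yk.
apply: (@glue_partial_iso _ unit R R' (chain (R (Some (Some tt))))
  (chain (R' (Some (Some tt)))) _ _ (fun=> tt) (fun=> tt)).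
- exact: chain_equivalence.
- exact: chain_equivalence.
- by move=> u v xu /(chain_block nestedR) uv; split=> //; apply: Ft xu uv.
- by move=> u v xu /(chain_block nestedR') uv; split=> //; apply: F't xu uv.
- move=> [] n.
  have dropt (K : nat -> nat -> Prop) (C : set nat) :
      many K [set z | C z /\ tt = tt] n <-> many K C n.
    by apply: many_eq => z; split=> [[]|].
  apply: iff_trans (dropt _ _) (iff_trans _ (iff_sym (dropt _ _))).
  exact: chain_count_many xk yk n.
- by move=> u v xu yv _; apply: chain_partial_iso.
- move=> [[[]|]|] u v u' v' xu xv yu' yv' nuv nuv'.
  (* Points joined by S lie in one chain, one step apart, so S fails between different chains. *)
  + split=> [uv|uv]; [case: nuv|case: nuv']; exists 1; left.
      by exists v.
    by exists v'.
  + split=> _; first by apply: F't yv'; apply: F's.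
    by apply: Ft xv; apply: Fs.
  + split=> _; first by apply: FE'; apply: F't yv'; apply: F's.
    by apply: FE; apply: Ft xv; apply: Fs.
Qed.

(** The type of an F-class is its chain count. F-classes of equal type are isomorphic by
    [block_partial_iso], and the hypothesis counts them for each type. *)
Lemma class_partial_iso x y :
  (forall k n, many_blocks R x k n <-> many_blocks R' y k n) ->
  partial_iso R R' [set z | R None x z] [set z | R' None y z].
Proof.
have [[Er Es Et] [Fr Fs Ft] FE SF axS] := nestedR.
have [[E'r E's E't] [F'r F's F't] FE' SF' axS'] := nestedR'.
move=> xy.
have /choice[t tP] := chain_count_ex nestedR.
have /choice[u uP] := chain_count_ex nestedR'.
have tE z k : chain_count R z k <-> t z = k.
  by split=> [H|<-//]; apply: chain_count_unique H.
have uE z k : chain_count R' z k <-> u z = k.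
  by split=> [H|<-//]; apply: chain_count_unique H.
apply: (@glue_partial_iso _ nat R R' (R (Some None)) (R' (Some None)) _ _ t u).
- by [].
- by [].
- move=> z w xz zw; split; first by apply: Et xz _; apply: FE.
  by apply/tE; apply: (chain_count_block nestedR) (tP w); apply: Fs.
- move=> z w xz zw; split; first by apply: E't xz _; apply: FE'.
  by apply/uE; apply: (chain_count_block nestedR') (uP w); apply: F's.
- move=> k n; apply: iff_trans (iff_trans (xy k n) _); apply: many_eq => z /=.
    by rewrite (propext (tE _ _)).
  by rewrite (propext (uE _ _)).
- by move=> z w xz yw tu; apply: (@block_partial_iso _ _ (t z)) => //; rewrite tu.
- move=> [[[]|]|] z w z' w' xz xw yz' yw' nzw nzw'.
  + by split=> [/SF|/SF'].
  + by [].
  + split=> _; first by apply: E't yw'; apply: E's.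
    by apply: Et xw; apply: Es.
Qed.

(** Isomorphisms preserve codes. Conversely, the E-classes are glued with their block counts as
    types: equal ranges provide the same types in both models, and the multiplicities inside the
    codes provide equally many classes of each. *)
Lemma code_isoP :
  (exists2 g, bijective g & forall j x y, R j x y <-> R' j (g x) (g y)) <->
  range (class_code R) = range (class_code R').
Proof.
have [eqE eqF FE SF axS] := nestedR; have [Er Es Et] := eqE.
have [eqE' eqF' FE' SF' axS'] := nestedR'; have [E'r E's E't] := eqE'.
split=> [[g g_bij gR]|codes].
  have [h gK hK] := g_bij.
  apply/seteqP; split=> _ [x _ <-].
    by exists (g x) => //; rewrite (class_code_iso g_bij gR).
  by exists (h x) => //; rewrite (class_code_iso g_bij gR) hK.
have blocksE Q Q' x y : class_code Q x = class_code Q' y ->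
    forall k n, many_blocks Q x k n <-> many_blocks Q' y k n.
  move=> xy k n.
  have := congr1 (fun f => f (pickle (inl (k, n) : nat * nat + nat))) xy.
  rewrite /class_code !pickleK; exact: asbool_eq_equiv.
have copiesE Q Q' x y : class_code Q x = class_code Q' y ->
    forall n, many_copies Q x n <-> many_copies Q' y n.
  move=> xy n.
  have := congr1 (fun f => f (pickle (inr n : nat * nat + nat))) xy.
  rewrite /class_code !pickleK; exact: asbool_eq_equiv.
pose t (Q : T2_signature -> nat -> nat -> Prop) (x : nat) : nat -> nat -> Prop :=
  many_blocks Q x.
have tP Q Q' x y : t Q x = t Q' y <->
    forall k n, many_blocks Q x k n <-> many_blocks Q' y k n.
  split=> [txy k n|xy]; first by rewrite -/(t Q x k n) txy.
  by apply/funext => k; apply/funext => n; apply/propext.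
(* A point of type [i] in [Q] shares its code with some point of [Q'], which then has the same type
   and equally many copies. An empty witness yields no point, but it only gives the bound 0. *)
have count Q Q' : (range (class_code Q) `<=` range (class_code Q')) ->
    forall i n, many (Q None) [set x | setT x /\ t Q x = i] n ->
      many (Q' None) [set x | setT x /\ t Q' x = i] n.
  move=> QQ' i n H; have [s [sn us sA sE]] := H.
  case: s sn us sA sE => [<- _ _ _|x s _ _ sA _]; first exact: many0.
  have [_ tx] := sA x (mem_head _ _).
  have [y _ yx] := QQ' (class_code Q x) (ex_intro2 _ _ x I erefl).
  have ty : t Q' y = i by rewrite -tx; apply/tP/blocksE.
  have mE Q'' z : t Q'' z = i -> many_copies Q'' z n <->
      many (Q'' None) [set x | setT x /\ t Q'' x = i] n.
    move=> tz; apply: many_eq => w /=.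
    rewrite -tz /same_blocks -(propext (tP _ _ _ _)).
    by split=> [->|[_ ->]].
  by apply/(mE _ _ ty)/(copiesE _ _ _ _ yx)/(mE _ _ tx).
have [g [_ g_inj g_surj] gR] : partial_iso R R' setT setT.
  apply: (@glue_partial_iso _ _ R R' (R None) (R' None) setT setT
    (t R) (t R')) => //.
  - move=> x y _ xy; split=> //; apply/tP => k n.
    exact: many_blocks_class.
  - move=> x y _ xy; split=> //; apply/tP => k n.
    exact: many_blocks_class.
  - by move=> i n; split; apply: count; rewrite codes.
  - by move=> x y _ _ /tP; apply: class_partial_iso.
  - move=> [[[]|]|] x y x' y' _ _ _ _ nxy nxy'.
    + by split=> [/SF/FE|/SF'/FE'].
    + by split=> [/FE|/FE'].
    + by [].
exists g; last by move=> j x y; apply: gR.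
by rewrite -setTT_bijective.
Qed.

End Isomorphism.

(** * Rigid models of REF(bin) *)

Definition agree (n : nat) (f g : nat -> bool) : Prop :=
  forall k, (k < n)%N -> f k = g k.

Lemma agree_all f g : (forall n, agree n f g) <-> f = g.
Proof.
split=> [fg|-> //]; apply/funext => k; exact: (fg k.+1).
Qed.

Definition REF_of (b : nat -> nat -> bool) : structure REF_language nat :=
  fun Ra => let a : 2.-tuple nat := projT2 Ra in
    `[< agree (projT1 Ra) (b (tnth a v0)) (b (tnth a v1)) >].

Section REFstructures.
Variable b : nat -> nat -> bool.

Lemma sat_REF_atom k n (i j : 'I_n) (v : n.-tuple nat) :
  sat (REF_of b) (REF_atom k i j) v <-> agree k (b (tnth v i)) (b (tnth v j)).
Proof.
have -> : sat (REF_of b) (REF_atom k i j) v =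
    `[< agree k (b (tnth v i)) (b (tnth v j)) >] by rewrite /= map_tuple2.
by split=> /asboolP.
Qed.

(** Density enters through the splitting axioms: both children of every node must carry a label. *)
Lemma REF_of_models : (forall f n, exists x, agree n (b x) f) ->
  models (REF_of b) REFbin.
Proof.
move=> dense p [[[->|[k _]]|[k _ <-]]|[k _ <-]].
- by move=> x y; apply/sat_REF_atom.
- move=> [[->|->]|->].
  + by move=> x; apply/sat_REF_atom.
  + by move=> x y /sat_REF_atom xy; apply/sat_REF_atom => l lk; rewrite xy.
  + move=> x y z [/sat_REF_atom xy /sat_REF_atom yz]; apply/sat_REF_atom => l lk.
    by rewrite xy // yz.
- move=> x y /sat_REF_atom xy; apply/sat_REF_atom => l lk.
  by apply: xy; apply: leqW.
- move=> x.
  (* The label [y] follows the branch of [x] below level [k] and leaves it at level [k]. *)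
  have [y xy] := dense (fun l => if l == k then ~~ b x k else b x l) k.+1.
  exists y; split; first split.
  + apply/sat_REF_atom => l lk; rewrite -[tnth _ v0]/y -[tnth _ v1]/x.
    by rewrite xy ?leqW // ltn_eqF.
  + move=> /sat_REF_atom /(_ k (ltnSn k)); rewrite -[tnth _ v0]/y -[tnth _ v1]/x.
    by rewrite xy // eqxx; case: (b x k).
  + move=> z /sat_REF_atom; rewrite -[tnth _ v0]/z -[tnth _ v2]/x => xz.
    have [xzk|nxzk] := eqVneq (b x k) (b z k); [left|right]; apply/sat_REF_atom => l.
      rewrite -[tnth _ v0]/z -[tnth _ v2]/x ltnS leq_eqVlt => /orP[/eqP ->//|].
      exact: xz.
    rewrite -[tnth _ v0]/z -[tnth _ v1]/y => lk; rewrite xy //.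
    move: lk; rewrite ltnS leq_eqVlt; case: eqVneq => [->|_] /=; last exact: xz.
    by case: (b x k) (b z k) nxzk => [] [].
Qed.

End REFstructures.

Lemma REF_of_isoP (b b' : nat -> nat -> bool) :
  isomorphic (REF_of b) (REF_of b') <->
  exists2 g, bijective g &
    forall n x y, agree n (b x) (b y) <-> agree n (b' (g x)) (b' (g y)).
Proof.
split=> -[g g_bij gR]; exists g => //.
  move=> n x y; have := gR n [tuple x; y]; rewrite map_tuple2.
  exact: asbool_eq_equiv.
move=> n a; apply: asbool_equiv_eq.
rewrite (tnth_map g (a : 2.-tuple nat) v0) (tnth_map g (a : 2.-tuple nat) v1).
exact: gR.
Qed.

(** * Branches with prescribed multiplicities *)

Definition digit (i k : nat) : bool := odd (i %/ 2 ^ k).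

Lemma digitS i k : digit i k.+1 = digit i./2 k.
Proof. by rewrite /digit expnS divnMA divn2. Qed.

Lemma digit0 i : digit i 0 = odd i.
Proof. by rewrite /digit divn1. Qed.

(** Halving shifts the digits, which allows an induction on a bound for both numbers. *)
Lemma digit_inj : injective digit.
Proof.
move=> i j; have [n] := ubnP (maxn i j); elim: n i j => // n IHn i j.
rewrite ltnS => ijn ij.
have odd_ij : odd i = odd j by rewrite -!digit0 ij.
have half_ij : digit i./2 = digit j./2.
  by apply/funext => k; rewrite -!digitS ij.
case: n IHn ijn => [|n] IHn ijn.
  by move: ijn; rewrite geq_max !leqn0 => /andP[/eqP -> /eqP ->].
rewrite -(odd_double_half i) -(odd_double_half j) odd_ij.
rewrite (IHn _ _ _ half_ij) //.
have n_half : (n.+1 <= n.*2.+1)%N by rewrite ltnS -addnn leq_addr.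
move: ijn; rewrite gtn_max geq_max !ltnS !leq_half_double => /andP[i_n j_n].
by rewrite !(leq_trans _ n_half).
Qed.

Lemma digit_dense f n : exists i, agree n (digit i) f.
Proof.
elim: n f => [|n IHn] f; first by exists 0.
have [i iP] := IHn (fun k => f k.+1).
exists (f 0 + i.*2) => -[_|k kn]; first by rewrite digit0 oddD odd_double addbF oddb.
by rewrite digitS half_bit_double iP.
Qed.

Lemma digit_small i k : (i <= k)%N -> digit i k = false.
Proof.
move=> ik; rewrite /digit divn_small //.
by apply: leq_ltn_trans ik _; apply: ltn_expl.
Qed.

(* The branch is true at all odd levels, hence differs from all [digit i]. *)
Definition pad (f : nat -> bool) (k : nat) : bool := odd k || f k./2.

Lemma pad_inj : injective pad.
Proof.
move=> f g fg; apply/funext => k.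
by have := congr1 (@^~ k.*2) fg; rewrite /pad odd_double doubleK.
Qed.

(** Level 2i + 1 separates the branches: it is odd, and the digits of [i] vanish from level [i]
    on. *)
Lemma pad_neq_digit f i : pad f <> digit i.
Proof.
move=> /(congr1 (@^~ i.*2.+1)).
rewrite digit_small /pad /= ?odd_double //.
by rewrite -addnn; apply/ltnW/leq_addr.
Qed.

(* For each a there are infinitely many leaves [inl (a, k)] on the branch
   [pad (X a)], while exactly i + 1 leaves lie on [digit i]: isomorphisms have to
   fix each of these branches, and they are dense. *)
Definition leaf : Type := (nat * nat + {i : nat & 'I_i.+1})%type.
HB.instance Definition _ := Countable.on leaf.
HB.instance Definition _ := isPointed.Build leaf (inl (0, 0)).

Definition branch (X : nat -> nat -> bool) (w : leaf) : nat -> bool :=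
  match w with inl p => pad (X p.1) | inr w => digit (projT1 w) end.

Lemma leaf_enum_ex : exists e : nat -> leaf, bijective e.
Proof.
have : [set: nat] #= [set: leaf].
  apply: card_esym; apply: eq_card_nat; first exact: countableP.
  apply/infiniteP/pcard_leP/injfunPex; exists (fun k => inl (k, 0)) => //.
  by move=> k l _ _ [].
by move=> /card_set_bijP[e]; rewrite setTT_bijective; exists e.
Qed.

Definition leaf_enum : nat -> leaf := sval (cid leaf_enum_ex).

Lemma leaf_enum_bij : bijective leaf_enum.
Proof. exact: svalP (cid leaf_enum_ex). Qed.

Section Branches.
Variable X : nat -> nat -> bool.
Let b (x : nat) : nat -> bool := branch X (leaf_enum x).

Lemma branch_cases x : (exists i, b x = digit i) \/ exists a, b x = pad (X a).
Proof.
rewrite /b; case: (leaf_enum x) => [[a k]|w]; first by right; exists a.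
by left; exists (projT1 w).
Qed.

Lemma branch_pad a : exists x, b x = pad (X a).
Proof.
have [h _ hK] := leaf_enum_bij.
by exists (h (inl (a, 0))); rewrite /b hK.
Qed.

Lemma branch_digit i : exists x, b x = digit i.
Proof.
have [h _ hK] := leaf_enum_bij.
by exists (h (inr (existT _ i ord0))); rewrite /b hK.
Qed.

Lemma card_branch f : [set x | b x = f] #= [set w | branch X w = f].
Proof.
have [h eK hK] := leaf_enum_bij.
have -> : [set w | branch X w = f] = leaf_enum @` [set x | b x = f].
  apply/seteqP; split=> [w wf|_ [x xf <-] //].
  by exists (h w); rewrite /= /b hK.
apply: card_esym; apply: inj_card_eq => x y _ _; exact: can_inj eK x y.
Qed.

(** Padded branches are never digit branches and [digit] is injective, so only the i + 1 leaves
    [inr] of index [i] lie here. *)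
Lemma card_branch_digit i : [set x | b x = digit i] #= `I_i.+1.
Proof.
apply: card_eq_trans (card_branch _) _.
have -> : [set w | branch X w = digit i] =
    (fun k : 'I_i.+1 => inr (existT _ i k) : leaf) @` setT.
  apply/seteqP; split=> [[p /pad_neq_digit //|[j k] /= /digit_inj ji]|_ [k _ <-] //].
  by case: _ / ji in k *; exists k.
apply: card_eq_trans (card_esym card_II); apply: inj_card_eq => k l _ _ kl.
have := congr1 (fun w : leaf => if w is inr v then projT2 v : nat else 0) kl.
exact: val_inj.
Qed.

Lemma infinite_branch_pad a : infinite_set [set x | b x = pad (X a)].
Proof.
apply/infiniteP; apply: (card_le_trans (B := [set w | branch X w = pad (X a)])).
  apply/pcard_leP/injfunPex; exists (fun k => inl (a, k)) => // k l _ _ [] //.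
by have /card_eqPle[] := card_branch (pad (X a)).
Qed.

Lemma branch_dense f n : exists x, agree n (b x) f.
Proof.
have [i iP] := digit_dense f n; have [x xi] := branch_digit i.
by exists x; rewrite xi.
Qed.

End Branches.

Definition REF_structure (X : nat -> nat -> bool) : structure REF_language nat :=
  REF_of (branch X \o leaf_enum).

Lemma REF_structure_models X : models (REF_structure X) REFbin.
Proof. by apply: REF_of_models => f n; apply: branch_dense. Qed.

(** A padded branch met by [X] is also met by [Y], where it cannot be a digit branch and so comes
    from a member of [range Y]. *)
Lemma branch_range_sub X Y (g : nat -> nat) :
  (forall x, branch Y (leaf_enum (g x)) = branch X (leaf_enum x)) ->
  range X `<=` range Y.
Proof.
move=> gb _ [a _ <-]; have [x xa] := branch_pad X a.
have [[i]|[c]] := branch_cases Y (g x); rewrite gb xa.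
  by move/pad_neq_digit.
by move=> /pad_inj ->; exists c.
Qed.

(** From right to left, equal ranges give each branch the same multiplicity in both models: i + 1 on
    [digit i], infinite on the padded members of the range, 0 elsewhere. The labels can then be
    matched branch by branch. *)
Lemma REF_structure_isoP X Y :
  isomorphic (REF_structure X) (REF_structure Y) <-> range X = range Y.
Proof.
rewrite (propext (REF_of_isoP _ _)) /=; split=> [[g g_bij gR]|XY].
  have [h gK hK] := g_bij.
  have g_eq x y : branch X (leaf_enum x) = branch X (leaf_enum y) <->
      branch Y (leaf_enum (g x)) = branch Y (leaf_enum (g y)).
    rewrite -!(propext (agree_all _ _)).
    by split=> H n; apply/gR.
  have g_digit x i : branch X (leaf_enum x) = digit i ->
      branch Y (leaf_enum (g x)) = digit i.
    move=> xi.
    have cardY : [set y | branch Y (leaf_enum y) = branch Y (leaf_enum (g x))]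
        #= `I_i.+1.
      apply: card_eq_trans (card_branch_digit X i).
      have -> : [set y | branch Y (leaf_enum y) = branch Y (leaf_enum (g x))] =
          g @` [set y | branch X (leaf_enum y) = digit i].
        apply/seteqP; split=> [y /= yx|_ [y /= yi <-]].
          by exists (h y) => //=; rewrite -xi; apply/g_eq; rewrite hK.
        by apply/g_eq; rewrite xi.
      by apply: inj_card_eq => y z _ _; exact: can_inj gK y z.
    (* On [digit j] there are j + 1 labels, which forces j = i; a padded branch would carry
       infinitely many. *)
    have [[j xj]|[a xa]] := branch_cases Y (g x).
      rewrite xj in cardY *.
      by have /card_eq_II :=
        card_eq_trans (card_esym (card_branch_digit Y j)) cardY; move => [->].
    by rewrite xa in cardY; case: (@infinite_branch_pad Y a); exists i.+1.
  have g_branch x : branch Y (leaf_enum (g x)) = branch X (leaf_enum x).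
    apply/funext => k.
    (* Bit [k] is read off from a label [y] on a digit branch that agrees with the branch of [x] up
       to level [k] inclusive: [g] keeps [y] on its branch and preserves this agreement. *)
    have [i iP] := digit_dense (branch X (leaf_enum x)) k.+1.
    have [y yi] := branch_digit X i.
    have := proj1 (gR k.+1 y x); rewrite yi (g_digit y i yi) => /(_ iP) <- //.
    exact: iP.
  apply/seteqP; split; first exact: branch_range_sub g_branch.
  by apply: (@branch_range_sub _ _ h) => x; rewrite -g_branch hK.
have [|g [_ g_inj g_surj] gb] := @set_bij_fibers nat nat _ setT setT
  (branch X \o leaf_enum) (branch Y \o leaf_enum).
  have setT_and (P : nat -> Prop) : [set x | setT x /\ P x] = [set x | P x].
    by apply/seteqP; split=> x //= [].
  move=> f; rewrite !setT_and.
  have [[i ->]|nfi] := pselect (exists i, f = digit i).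
    exact: card_eq_trans (card_branch_digit X i) (card_esym (card_branch_digit Y i)).
  have [[a fa]|nfX] := pselect (exists a, f = pad (X a)).
    have [c _ ca] : range Y (X a) by rewrite -XY; exists a.
    apply: (card_eq_trans (B := [set: nat])); last apply: card_esym.
      apply: eq_card_nat; first exact: countableP.
      by rewrite fa; exact: infinite_branch_pad.
    apply: eq_card_nat; first exact: countableP.
    by rewrite fa -ca; exact: infinite_branch_pad.
  have none Z : range Z = range X -> [set x | (branch Z \o leaf_enum) x = f] = set0.
    move=> ZX; apply/seteqP; split=> // x /= xf.
    have [[i xi]|[a xa]] := branch_cases Z x.
      by apply: nfi; exists i; rewrite -xf.
    have [c _ ca] : range X (Z a) by rewrite -ZX; exists a.
    by apply: nfX; exists c; rewrite -xf xa ca.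
  by rewrite !none.
exists g; first by rewrite -setTT_bijective.
by move=> n x y; have /= -> // := gb x I; have /= -> := gb y I.
Qed.

(** * Borel maps *)

Section BorelClosure.
Context {X : topologicalType}.
Implicit Types P Q : X -> Prop.

Lemma borel_not P : borel [set x | P x] -> borel [set x | ~ P x].
Proof. by rewrite -[[set x | ~ P x]]setTD; apply: sigma_algebraCD. Qed.

Lemma borel_const (p : Prop) : borel [set _ : X | p].
Proof.
have [yes|no] := pselect p.
  rewrite (_ : [set _ | p] = setT); last by apply/seteqP; split=> x.
  by apply: sub_sigma_algebra; apply: openT.
rewrite (_ : [set _ | p] = set0); last by apply/seteqP; split=> x.
exact: sigma_algebra0.
Qed.

(** The quantifier becomes a countable union over codes; an index that decodes to nothing
    contributes the empty set. *)
Lemma borel_exists (I : countType) (P : I -> X -> Prop) :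
  (forall i, borel [set x | P i x]) -> borel [set x | exists i, P i x].
Proof.
move=> bP; have -> : [set x | exists i, P i x] =
    \bigcup_n [set x | if unpickle n is Some i then P i x else False].
  apply/seteqP; split=> [x [i Pix]|x [n _]] /=.
    by exists (pickle i) => //=; rewrite pickleK.
  by case: unpickle => // i; exists i.
apply: sigma_algebra_bigcup => n.
by case: unpickle => [i|]; [exact: bP|exact: borel_const].
Qed.

Lemma borel_forall (I : countType) (P : I -> X -> Prop) :
  (forall i, borel [set x | P i x]) -> borel [set x | forall i, P i x].
Proof.
move=> bP; have -> : [set x | forall i, P i x] = [set x | ~ exists i, ~ P i x].
  apply/seteqP; split=> x /= H; first by move=> [i]; apply; apply: H.
  by move=> i; apply: contrapT => nP; apply: H; exists i.
by apply: borel_not; apply: borel_exists => i; apply: borel_not.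
Qed.

Lemma borel_and P Q : borel [set x | P x] -> borel [set x | Q x] ->
  borel [set x | P x /\ Q x].
Proof.
move=> bP bQ; have -> : [set x | P x /\ Q x] =
    [set x | forall i : bool, if i then P x else Q x].
  apply/seteqP; split=> [x [Px Qx] []|x PQ] //.
  by split; [apply: (PQ true)|apply: (PQ false)].
by apply: borel_forall => -[].
Qed.

Lemma borel_imp P Q : borel [set x | P x] -> borel [set x | Q x] ->
  borel [set x | P x -> Q x].
Proof.
move=> bP bQ; have -> : [set x | P x -> Q x] = [set x | ~ (P x /\ ~ Q x)].
  apply/seteqP; split=> x /= H; first by move=> [Px []]; apply: H.
  by move=> Px; apply: contrapT => nQ; apply: H.
by apply: borel_not; apply: borel_and => //; apply: borel_not.
Qed.

Lemma borel_or P Q : borel [set x | P x] -> borel [set x | Q x] ->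
  borel [set x | P x \/ Q x].
Proof.
move=> bP bQ; have -> : [set x | P x \/ Q x] = [set x | ~ P x -> Q x].
  apply/seteqP; split=> x /=; first by case.
  by have [|nP] := pselect (P x); [left|right; auto].
by apply: borel_imp => //; apply: borel_not.
Qed.

Lemma borel_iff P Q : borel [set x | P x] -> borel [set x | Q x] ->
  borel [set x | P x <-> Q x].
Proof. by move=> bP bQ; apply: borel_and; apply: borel_imp. Qed.

Lemma borel_exists2 (I : countType) (P Q : I -> X -> Prop) :
  (forall i, borel [set x | P i x]) -> (forall i, borel [set x | Q i x]) ->
  borel [set x | exists2 i, P i x & Q i x].
Proof.
move=> bP bQ; have -> : [set x | exists2 i, P i x & Q i x] =
    [set x | exists i, P i x /\ Q i x].
  by apply/seteqP; split=> x /= [i]; [exists i|case; exists i].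
by apply: borel_exists => i; apply: borel_and.
Qed.

Lemma borel_many (E : X -> nat -> nat -> Prop) (A : X -> nat -> Prop) n :
  (forall y z, borel [set x | E x y z]) -> (forall y, borel [set x | A x y]) ->
  borel [set x | many (E x) [set y | A x y] n].
Proof.
move=> bE bA; have -> : [set x | many (E x) [set y | A x y] n] =
    [set x | exists s : seq nat, (size s = n /\ uniq s) /\
      ((forall y, y \in s -> A x y) /\
       forall y z, y \in s -> z \in s -> E x y z -> y = z)].
  apply/seteqP; split=> x /= [s]; first by case; exists s.
  by move=> [[? ?] [? ?]]; exists s.
apply: borel_exists => s; apply: borel_and; first exact: borel_const.
apply: borel_and.
  by apply: borel_forall => y; apply: borel_imp => //; apply: borel_const.
do 2!apply: borel_forall => ?.
do 2!(apply: borel_imp; first exact: borel_const).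
by apply: borel_imp => //; apply: borel_const.
Qed.

Section BorelCode.
Variable R : X -> T2_signature -> nat -> nat -> Prop.
Hypothesis bR : forall j y z, borel [set x | R x j y z].

Lemma borel_steps n y z :
  borel [set x | steps setT (R x (Some (Some tt))) n y z].
Proof.
elim: n y => [|n IHn] y /=; first exact: borel_const.
apply: borel_exists2 => w; first exact: borel_const.
exact: borel_and.
Qed.

Lemma borel_many_chains y n : borel [set x | many_chains (R x) y n].
Proof.
apply: borel_many => // z w; apply: borel_exists => m.
by apply: borel_or; apply: borel_steps.
Qed.

Lemma borel_chain_count y k : borel [set x | chain_count (R x) y k].
Proof.
case: k => [|k]; first by apply: borel_forall => n; apply: borel_many_chains.
by apply: borel_and; [|apply: borel_not]; apply: borel_many_chains.
Qed.

Lemma borel_many_blocks y k n : borel [set x | many_blocks (R x) y k n].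
Proof.
by apply: borel_many => // z; apply: borel_and => //; apply: borel_chain_count.
Qed.

Lemma borel_many_copies y n : borel [set x | many_copies (R x) y n].
Proof.
apply: borel_many => // z; do 2!apply: borel_forall => ?.
by apply: borel_iff; apply: borel_many_blocks.
Qed.

Lemma borel_class_code y m : borel [set x | class_code (R x) y m].
Proof.
rewrite /class_code; case: unpickle => [[[k n]|n]|]; last exact: borel_const.
  rewrite (_ : [set x | _] = [set x | many_blocks (R x) y k n]).
    exact: borel_many_blocks.
  by apply/seteqP; split=> x /asboolP.
rewrite (_ : [set x | _] = [set x | many_copies (R x) y n]).
  exact: borel_many_copies.
by apply/seteqP; split=> x /asboolP.
Qed.

End BorelCode.

(** An atom of level n compares two branches on n bits, each of which is a constant or a bit of
    [f x]. *)
Lemma borel_REF_structure (f : X -> nat -> nat -> bool) :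
  (forall a k, borel [set x | f x a k]) ->
  forall Ra, borel [set x | REF_structure (f x) Ra].
Proof.
move=> bf [n a]; have bb w k : borel [set x | branch (f x) w k].
  case: w => [[c l]|w]; last exact: (borel_const (digit (projT1 w) k)).
  by rewrite /= /pad; case: odd => /=; [exact: (borel_const true)|exact: bf].
pose l := leaf_enum (tnth (a : 2.-tuple nat) v0).
pose r := leaf_enum (tnth (a : 2.-tuple nat) v1).
rewrite (_ : [set x | _] = [set x | forall k, (k < n)%N ->
    (branch (f x) l k <-> branch (f x) r k)]).
  apply: borel_forall => k; apply: borel_imp; first exact: borel_const.
  by apply: borel_iff.
apply/seteqP; split=> x.
  by move=> /asboolP lr k kn; rewrite [branch _ l k](lr k kn).
move=> lr; apply/asboolP => k kn; apply/idP/idP; by move/(lr k kn).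
Qed.

End BorelClosure.

(** Around each of its points an open set contains a finite intersection of preimages under
    projections, and each of these looks at one coordinate. *)
Lemma open_finite_support (I : choiceType)
    (O : set (prod_topology (fun _ : I => bool))) M :
  open O -> O M ->
  exists s : seq I, forall N, (forall i, i \in s -> N i = M i) -> O N.
Proof.
move=> oO OM; have : nbhs M O by apply: open_nbhs_nbhs.
move=> [P [[Q Qfin <-] [V QV VM] QO]].
have [/= G Gsub GV] := Qfin _ QV.
pose G' : seq (set (prod_topology (fun _ : I => bool))) := finmap.enum_fset G.
have /choice[w wP] (W : set (prod_topology (fun _ : I => bool))) :
    exists w : seq I, W \in G' ->
      forall N, (forall i, i \in w -> N i = M i) -> W N.
  have [WG|nWG] := boolP (W \in G'); last by exists [::].
  have /set_mem[i _ [C _ CW]] := Gsub _ WG.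
  have WM : W M by move: VM; rewrite -GV; apply.
  exists [:: i] => _ N NM; rewrite -CW /= NM ?mem_head //.
  by move: WM; rewrite -CW.
exists (flatten [seq w W | W <- G']) => N NM; apply: QO; exists V => //.
suff VN : (V : set (prod_topology (fun _ : I => bool))) N by exact: VN.
rewrite -GV => W WG; apply: (wP W WG) => i iw; apply: NM.
by apply/flattenP; exists (w W) => //; apply: map_f.
Qed.

(** It suffices to treat open sets. An open set is a union of cylinders given by finite partial
    diagrams, and there are only countably many of these because the language is countable. *)
Lemma borel_map_Mod (X : topologicalType) (L : language) (T : theory L)
    (f : X -> Mod T) :
  (forall Ra, borel [set x | set_val (f x) Ra]) -> borel_map f.
Proof.
move=> bf.
pose I := {R : L & (arity R).-tuple nat}.
apply: smallest_sub.
  split.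
  - by rewrite preimage_set0; apply: sigma_algebra0.
  - by move=> A bA; rewrite setTD preimage_setC -setTD; apply: sigma_algebraCD.
  - by move=> A bA; rewrite preimage_bigcup; apply: sigma_algebra_bigcup.
move=> _ [O oO <-].
(* Here [s] prescribes finitely many truth values that force a structure into [O]. *)
have -> : f @^-1` (set_val @^-1` O) = [set x | exists s : seq (I * bool),
    (forall N, (forall p, p \in s -> N p.1 = p.2) -> O N) /\
    forall p, p \in s -> (set_val (f x) p.1 <-> p.2)].
  apply/seteqP; split=> x /=.
    move=> Ofx; have [s sP] := open_finite_support oO Ofx.
    exists [seq (i, set_val (f x) i) | i <- s]; split=> [N NM|_ /mapP[i _ ->] //].
    by apply: sP => i iS; apply: (NM (i, _)); apply: map_f.
  by move=> [s [sO sx]]; apply: sO => p ps; apply/idP/idP => /(sx p ps).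
apply: borel_exists => s; apply: borel_and; first exact: borel_const.
apply: borel_forall => p; apply: borel_imp; first exact: borel_const.
by apply: borel_iff; [exact: bf|exact: borel_const].
Qed.

Lemma borel_atom (L : language) (T : theory L)
    (Ra : {R : L & (arity R).-tuple nat}) :
  borel [set M : Mod T | set_val M Ra].
Proof.
apply: sub_sigma_algebra.
exists [set N : structure L nat | N Ra] => //.
apply: (@open_comp (structure L nat) bool (fun N => N Ra) [set true]).
  by move=> N _; apply: proj_continuous.
exact: discrete_open.
Qed.

(** * The reduction *)

Lemma borel_T2_rel j x y : borel [set M : Mod T2 | T2_rel (set_val M) j x y].
Proof. by case: j => [[u|]|]; apply: borel_atom. Qed.

Definition class_codes (M : Mod T2) : nat -> nat -> bool :=
  class_code (T2_rel (set_val M)).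

Definition T2_to_REF (M : Mod T2) : Mod REFbin :=
  exist _ (REF_structure (class_codes M))
    (mem_set (A := Mod REFbin) (REF_structure_models (class_codes M))).

Lemma tuple2_eta (T : Type) (a : 2.-tuple T) : a = [tuple tnth a v0; tnth a v1].
Proof.
apply: eq_from_tnth => i; case: (unliftP ord0 i) => [j|] -> //.
by rewrite ord1.
Qed.

Lemma T2_isomorphicP (U V : Type)
    (M : structure (jump_language (jump_language succ_language)) U)
    (N : structure (jump_language (jump_language succ_language)) V) :
  isomorphic M N <-> exists2 g, bijective g &
    forall j x y, T2_rel M j x y <-> T2_rel N j (g x) (g y).
Proof.
split=> -[g g_bij gR]; exists g => //.
  move=> [[[]|]|] x y.
  - have := gR (Some (Some tt)) [tuple x; y].
    by rewrite map_tuple2 /T2_rel /succ_rel /holds /= /reduct /holds /= => ->.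
  - have := gR (Some None) [tuple x; y].
    by rewrite map_tuple2 /T2_rel /same_class /holds /= /reduct /holds /= => ->.
  - have := gR None [tuple x; y].
    by rewrite map_tuple2 /T2_rel /same_class /holds /= => ->.
have iff_eq (b c : bool) : (b <-> c) -> b = c by move=> [bc cb]; apply/idP/idP.
move=> [[[]|]|] a.
- have /iff_eq := gR (Some (Some tt)) (tnth (a : 2.-tuple U) v0)
    (tnth (a : 2.-tuple U) v1).
  by rewrite /T2_rel /succ_rel -(map_tuple2 g) -!tuple2_eta.
- have /iff_eq := gR (Some None) (tnth (a : 2.-tuple U) v0)
    (tnth (a : 2.-tuple U) v1).
  by rewrite /T2_rel /same_class -(map_tuple2 g) -!tuple2_eta.
- have /iff_eq := gR None (tnth (a : 2.-tuple U) v0) (tnth (a : 2.-tuple U) v1).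
  by rewrite /T2_rel /same_class -(map_tuple2 g) -!tuple2_eta.
Qed.

Theorem theorem5p3 : borel_reducible (Mod_iso T2) (Mod_iso REFbin).
Proof.
exists T2_to_REF.
  apply: borel_map_Mod => Ra; apply: borel_REF_structure => a k.
  by apply: borel_class_code => j y z; apply: borel_T2_rel.
(* Both isomorphism relations are equivalent to the equality of the two sets of class codes. *)
move=> M N; apply: iff_trans (T2_isomorphicP _ _) _.
apply: iff_trans (iff_sym (REF_structure_isoP (class_codes M) (class_codes N))).
by apply: code_isoP; apply: T2_nested; [exact: (set_valP M)|exact: (set_valP N)].
Qed.
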